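(* Let $n\ge2$ be an integer. There exists a point $(x,\mathbf{a})\in\mathbb{R}^{n+1}$, $\mathbf{a}=(a_2,\dots,a_{n+1})$, such that \[ x\ge n,\quad \mathbf{a}\in\mathcal{A}(x),\quad F_n=F(x,\mathbf{a}). \] Moreover, every such point has the following properties: \begin{enumerate} \item there exists $\ell\in\{2,\dots,n\}$ such that $F_n=2(x-n)+\ell-1$ and $x=(2-\theta)F_n$, where $\theta=\big(F_n/(F_n+1)\big)^{n+1-\ell}$; \item $a_2=\cdots=a_\ell=1$ and $a_k=2-\big(F_n/(F_n+1)\big)^{k-\ell}$ for $k=\ell,\dots,n+1$; \item $F_n=\dfrac{A_{\ell+1}(x,\mathbf{a})}{a_{\ell+1}}=\cdots=\dfrac{A_{n+1}(x,\mathbf{a})}{a_{n+1}}$. \end{enumerate}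
   Context: For real $x\ge n$ let $\mathcal{A}(x)=\{\mathbf{a}=(a_2,\dots,a_{n+1})\in\mathbb{R}^n:\ 1=a_2\le\cdots\le a_{n+1},\ a_2+\cdots+a_{n+1}=x\}$. For $\mathbf{a}\in\mathcal{A}(x)$ and $2\le k\le n+1$ let $A_k(x,\mathbf{a})=2x-2(n-k+1)-\sum_{i=2}^k a_i$, $F(x,\mathbf{a})=\max_{2\le k\le n+1}A_k(x,\mathbf{a})/a_k$, $F(x)=\min_{\mathbf{a}\in\mathcal{A}(x)}F(x,\mathbf{a})$, and $F_n=\inf_{x\ge n}F(x)$. *)

(* Defs.v *)
From HB Require Import structures.
From mathcomp Require Import all_boot all_order all_algebra.
From mathcomp Require Import all_classical all_reals all_analysis.
From mathcomp Require Import zify ring lra.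
Set Implicit Arguments.
Unset Strict Implicit.
Unset Printing Implicit Defensive.
Import Order.TTheory GRing.Theory Num.Theory.
Import numFieldNormedType.Exports.
Local Open Scope classical_set_scope.
Local Open Scope ring_scope.

(* The coordinates of a vector a = (a_2, ..., a_{n+1}) are numbered from 2:
   [entry a k] is a_k for 2 <= k <= n + 1.  Its other values are irrelevant. *)
Definition entry (R : realType) (n : nat) (a : 'rV[R]_n) (k : nat) : R :=
  if insub (k - 2)%N is Some i then a ord0 i else 0.

Definition calA (R : realType) (n : nat) (x : R) : set 'rV[R]_n :=
  [set a | [/\ entry a 2 = 1,
               forall k : nat, (2 <= k <= n)%N -> entry a k <= entry a k.+1
             & \sum_(2 <= i < n.+2) entry a i = x]].
Arguments calA {R} n x _.

(* The subtraction n - k + 1 is taken in R, not in nat. *)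
Definition A_ (R : realType) (n : nat) (x : R) (a : 'rV[R]_n) (k : nat) : R :=
  2 * x - 2 * (n%:R - k%:R + 1) - \sum_(2 <= i < k.+1) entry a i.

(* R has no least element, so the iterated maximum starts from its own k = 2
   term. *)
Definition Fxa (R : realType) (n : nat) (x : R) (a : 'rV[R]_n) : R :=
  \big[Num.max/A_ x a 2 / entry a 2]_(2 <= k < n.+2) (A_ x a k / entry a k).

(* This infimum is a minimum: see [Fx_min] below. *)
Definition Fx (R : realType) (n : nat) (x : R) : R :=
  inf [set Fxa x a | a in calA n x].

Definition Fn (R : realType) (n : nat) : R :=
  inf [set Fx n x | x in [set x : R | n%:R <= x]].

Section wellposed.
Variables (R : realType) (n : nat).
Implicit Types (x : R) (a : 'rV[R]_n).

Lemma entryE a (i : 'I_n) : entry a i.+2 = a ord0 i.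
Proof. by rewrite /entry subn2 /= valK. Qed.

Lemma entry_continuous k : continuous (fun a : 'rV[R]_n => entry a k).
Proof.
move=> a; rewrite /entry; case: (insub _ : option 'I_n) => [i|].
  exact: coord_continuous.
exact: (@cst_continuous _ _ (0 : R)).

Qed.

Lemma sum_entry_continuous m p :
  continuous (fun a : 'rV[R]_n => \sum_(m <= i < p) entry a i).
Proof.
move=> a; apply: (@continuous_big) => [|i _]; last exact: entry_continuous.
exact: add_continuous.
Qed.

Lemma entry_ge1 x a k : calA n x a -> (2 <= k <= n.+1)%N -> 1 <= entry a k.
Proof.
case=> a1 amono _; elim: k => [//|k IH] /andP[k2 kn].
have [k1|k1] := leqP k 1.
  by have -> : k = 1%N; [lia|rewrite a1].
by rewrite (le_trans (IH _)) ?amono //; lia.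
Qed.

Lemma entry_le x a k : calA n x a -> (2 <= k <= n.+1)%N -> entry a k <= x.
Proof.
move=> Aa kn; have [_ _ <-] := Aa.
rewrite (big_cat_nat (n := k)) /=; [|lia|lia].
rewrite [X in _ + X]big_ltn; last lia.
rewrite addrCA lerDl addr_ge0 // big_nat_cond sumr_ge0 // => i /andP[ik _];
  by rewrite (le_trans ler01) // (entry_ge1 Aa) //; lia.
Qed.

Lemma calA_nonempty x : (2 <= n)%N -> n%:R <= x -> calA n x !=set0.
Proof.
move=> n2 nx; exists (\row_i if i.+1 == n :> nat then x - n%:R + 1 else 1).
set a := \row__ _.
have ak k : (2 <= k <= n.+1)%N ->
    entry a k = if k == n.+1 then x - n%:R + 1 else 1.
  case: k => [|[|k]] //= kn; have kn' : (k < n)%N by lia.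
  by rewrite (entryE a (Ordinal kn')) mxE eqSS.
split.
- by rewrite ak //; [case: eqP => //; lia|lia].
- move=> k kn; rewrite !ak; [|lia|lia].
  by do 2!case: eqP; rewrite ?lexx //; try lia; move=> *; lra.
- rewrite big_nat_recr /=; last lia.
  rewrite ak ?eqxx; last lia.
  rewrite (eq_big_nat _ _ (F2 := fun=> 1)) => [|i ik]; last first.
    by rewrite ak; [case: eqP => //; lia|lia].
  rewrite big_const_nat iter_addr_0 (_ : (n.+1 - 2 = n.-1)%N); last lia.
  by rewrite -[n in x - n%:R](@prednK n) -?natr1; [ring|lia].
Qed.

Lemma calA_compact x : compact (calA n x : set 'rV[R]_n).
Proof.
apply: (@subclosed_compact _ _
  [set v : 'rV[R]_n | forall i : 'I_n, `[1, x]%classic (v ord0 i)]).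
- rewrite (_ : calA n x = [set a | entry a 2 = 1] `&`
    (\bigcap_(k in [set k | (2 <= k <= n)%N]) [set a | 0 <= entry a k.+1 - entry a k])
    `&` [set a | \sum_(2 <= i < n.+2) entry a i = x]).
    apply: closedI; first apply: closedI.
    + apply: (closed_comp _ (@closed_eq R^o 1)) => a _; exact: entry_continuous.
    + apply: closed_bigI => k _.
      apply: (closed_comp _ (@closed_ge R 0)) => a _.
      by apply: (@continuousB R R^o _ (fun b : 'rV[R]_n => entry b k.+1)
        (fun b : 'rV[R]_n => entry b k)); exact: entry_continuous.
    + apply: (closed_comp _ (@closed_eq R^o x)) => a _.
      exact: sum_entry_continuous.
  apply/seteqP; split => a /=.
    by move=> [a1 am ax]; do 2?split => //; move=> k /= kn; rewrite subr_ge0 am.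
  by move=> [[a1 am] ax]; split => // k kn; have := am k kn; rewrite /= subr_ge0.
- apply: (@rV_compact R n (fun=> `[1, x]%classic)) => _.
  exact: segment_compact.
- move=> a Aa i; rewrite /= in_itv /= -entryE.
  by rewrite (entry_ge1 Aa) ?(entry_le Aa) //; have := ltn_ord i; lia.
Qed.

Lemma Fxa_continuous x : (2 <= n)%N -> {within calA n x, continuous (@Fxa R n x)}.
Proof.
move=> n2; apply: continuous_in_subspaceT => a /set_mem Aa.
have cont k : (2 <= k < n.+2)%N ->
    {for a, continuous (fun b : 'rV[R]_n => A_ x b k / entry b k)}.
  move=> kn.
  apply: (@continuousM R _ (fun b : 'rV[R]_n => A_ x b k)
    (fun b : 'rV[R]_n => (entry b k)^-1)).
    apply: (@continuousB R R^o _
      (fun=> 2 * x - 2 * (n%:R - k%:R + 1))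
      (fun b : 'rV[R]_n => \sum_(2 <= i < k.+1) entry b i)).
      exact: cst_continuous.
    exact: sum_entry_continuous.
  apply: continuousV; last exact: entry_continuous.
  by rewrite gt_eqF // (lt_le_trans ltr01) // (entry_ge1 Aa).
rewrite /Fxa.
have : {subset index_iota 2 n.+2 <= index_iota 2 n.+2} by [].
elim: {1 3}(index_iota 2 n.+2) => [_|k s IH sub].
  by under eq_fun do rewrite big_nil; apply: cont; lia.
under eq_fun do rewrite big_cons.
apply: (@continuous_max R _ (fun b : 'rV[R]_n => A_ x b k / entry b k)
  (fun b : 'rV[R]_n => \big[Num.max/A_ x b 2 / entry b 2]_(i <- s)
    (A_ x b i / entry b i))).
  by apply: cont; have := sub k (mem_head _ _); rewrite mem_index_iota.
by apply: IH => i is_; apply: sub; rewrite inE is_ orbT.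
Qed.

Lemma Fxa_ge1 x a : n%:R <= x -> calA n x a -> 1 <= Fxa x a.
Proof.
move=> nx [a1 _ _]; apply: (le_trans _ (bigmax_ge_id _ _ _ _)).
by rewrite /A_ big_nat1 a1 divr1; lra.
Qed.

Lemma Fx_min x : (2 <= n)%N -> n%:R <= x ->
  exists2 a, calA n x a & Fxa x a = Fx n x /\
    forall b, calA n x b -> Fxa x a <= Fxa x b.
Proof.
move=> n2 nx.
have [a /set_mem Aa amin] := compact_EVT_min (calA_nonempty n2 nx)
  (@calA_compact x) (@Fxa_continuous x n2).
exists a => //; split; last by move=> b Ab; apply: amin; exact/mem_set.
apply/eqP; rewrite eq_le; apply/andP; split.
  apply: lb_le_inf; first by exists (Fxa x a), a.
  by move=> _ [b Ab <-]; apply: amin; exact/mem_set.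
apply: ge_inf; last by exists a.
by exists 1 => _ [b Ab <-]; exact: Fxa_ge1.
Qed.

Lemma Fn_has_inf : (2 <= n)%N ->
  has_inf [set Fx n x | x in [set x : R | n%:R <= x]].
Proof.
move=> n2; split; first by exists (Fx n (n%:R : R)), n%:R => //=.
exists 1 => _ [x nx <-]; have [a Aa [<- _]] := Fx_min n2 nx.
exact: Fxa_ge1.
Qed.

End wellposed.

(* Main.v *)
Require Import Defs.
From mathcomp Require Import all_boot all_order all_algebra.
From mathcomp Require Import all_classical all_reals all_analysis.
From mathcomp Require Import zify ring lra.
Import Order.TTheory GRing.Theory Num.Theory.
Import numFieldNormedType.Exports.
Local Open Scope classical_set_scope.
Local Open Scope ring_scope.

(* Write t for F_n, y = x - n and q = t / (t + 1).  In terms of the partial sums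
   S_k = a_2 + ... + a_k, the constraint A_k <= t a_k reads
   (t + 1) S_k >= t S_(k-1) + 2 (y + k - 1).  Choose an integer l and
   0 < d <= 1 with t = 2 y + l - d.  Iterating the constraints from S_l >= l - 1
   bounds S_k below by the sequence for which they are equalities, so
   x = S_(n+1) must be at least its last term; let gap(l, d, t) be the
   difference.  Conversely, if gap(l, d, t) >= 0 and y >= 0, that sequence, with
   its last term raised to x, is admissible, so F_n <= t.  If gap > 0, there is
   room to decrease t; hence gap = 0 at an optimum and a is the tight sequence.
   Since gap is affine in d with slope q^(n+1-l) - 1/2, it could be made positive
   by moving d if 0 < d < 1, unless the slope vanishes; in that case gap = 0
   makes t half-integral, which contradicts q^(n+1-l) = 1/2 by comparing 2-adic
   valuations.  Hence d = 1, and the formulas follow.  A minimum exists by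
   compactness, since F(x, a) >= 2 (x - n) + 1 bounds x. *)

(** Equality of the 2-adic valuations would read [1 + j v(p) = j v(p + 2)], so [j] divides 1; then
    [2 p = p + 2] contradicts [2 < p]. *)
Lemma exp_add2_neq (p j : nat) : (2 < p)%N -> (0 < j)%N ->
  (2 * p ^ j <> (p + 2) ^ j)%N.
Proof.
move=> p2 j0 E; have := congr1 (logn 2) E.
rewrite lognM ?expn_gt0 ?lognX //; last by rewrite (ltn_trans _ p2).
rewrite (_ : logn 2 2 = 1)%N // => e.
have : (j %| 1)%N.
  by rewrite -(@dvdn_addl (j * logn 2 p)) ?dvdn_mulr // e dvdn_mulr.
by rewrite dvdn1 => /eqP j1; move: E; rewrite j1 !expn1; lia.
Qed.

Section optimum.
Set Implicit Arguments.
Unset Strict Implicit.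
Variables (R : realType) (n : nat).
Implicit Types (x t d : R) (a : 'rV[R]_n) (s : nat -> R) (l k : nat).

(** * The tight sequence and its gap *)

Definition ratio t : R := t / (t + 1).

(* With [x - n = (t - (l - d)) / 2], these are the partial sums
   [a_2 + ... + a_k] for [k >= l] when [a_2 = ... = a_l = 1] and all later
   constraints [A_k <= t * a_k] are equalities. *)
Definition tight_sum l d t k : R :=
  2 * (k%:R - 1) - l%:R + d - t + (t + 1 - d) * ratio t ^+ (k - l).

Definition gap l d t : R :=
  2 * t - (t + 1 - d) * ratio t ^+ (n.+1 - l) - (t + d - l%:R) / 2 - n%:R.

Lemma gapE l d t :
  gap l d t = (t + d - l%:R) / 2 + n%:R - tight_sum l d t n.+1.
Proof. by rewrite /gap /tight_sum -[n.+1%:R]natr1; lra. Qed.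

Lemma ratio_bounds t : 0 < t -> 0 < ratio t < 1.
Proof.
move=> t0; have t1 : 0 < t + 1 by lra.
by rewrite /ratio divr_gt0 // ltr_pdivrMr // mul1r; lra.
Qed.

Lemma ratio_homo t t' : 0 < t -> t <= t' -> ratio t <= ratio t'.
Proof.
move=> t0 tt; rewrite /ratio ler_pdivrMr; last lra.
by rewrite mulrAC ler_pdivlMr; [nra|lra].
Qed.

Lemma ratioM t : 0 < t -> (t + 1) * ratio t = t.
Proof. by move=> t0; rewrite /ratio mulrC divfK // gt_eqF //; lra. Qed.

Lemma tight_sum_start l d t : tight_sum l d t l = l%:R - 1.
Proof. by rewrite /tight_sum subnn expr0; lra. Qed.

Lemma tight_sum_rec l d t k : 0 < t -> (l <= k)%N ->
  (t + 1) * tight_sum l d t k.+1 =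
  t * tight_sum l d t k + 2 * ((t + d - l%:R) / 2 + k%:R).
Proof.
move=> t0 lk; rewrite /tight_sum subSn // exprS -[k.+1%:R]natr1.
have := ratioM t0; set q := ratio t; set p := q ^+ _; move=> tq.
have -> : t * (2 * (k%:R - 1) - l%:R + d - t + (t + 1 - d) * p) =
  t * (2 * (k%:R - 1) - l%:R + d - t) + (t + 1 - d) * p * ((t + 1) * q).
  by rewrite tq; ring.
by field.
Qed.

Lemma tight_sum_step l d t k : 0 < t -> (l <= k)%N ->
  tight_sum l d t k.+1 - tight_sum l d t k =
  2 - (t + 1 - d) / (t + 1) * ratio t ^+ (k - l).
Proof.
move=> t0 lk; rewrite /tight_sum subSn // exprS -[k.+1%:R]natr1 /ratio.
by field; rewrite gt_eqF //; lra.
Qed.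

Lemma sum_entry_ge x a k : calA n x a -> (1 <= k <= n.+1)%N ->
  k%:R - 1 <= \sum_(2 <= i < k.+1) entry a i.
Proof.
move=> Aa kn; have -> : k%:R - 1 = \sum_(2 <= i < k.+1) 1 :> R.
  by rewrite sumr_const_nat subSS natrB //; lia.
by apply: ler_sum_nat => i ik; apply: (entry_ge1 Aa); lia.
Qed.

Variable n2 : (2 <= n)%N.

(** * Existence of a minimum *)

Lemma Fn_le_Fxa x a : n%:R <= x -> calA n x a -> Fn R n <= Fxa x a.
Proof.
move=> nx Aa; apply: (@le_trans _ _ (Fx n x)).
  by apply: ge_inf; [exact: (Fn_has_inf R n2).2|exists x].
have [b Ab [<- bmin]] := Fx_min n2 nx; exact: bmin.
Qed.

Lemma Fxa_leP x a t : calA n x a ->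
  reflect (forall k, (2 <= k <= n.+1)%N -> A_ x a k <= t * entry a k)
          (Fxa x a <= t).
Proof.
move=> Aa; have a_gt0 k : (2 <= k <= n.+1)%N -> 0 < entry a k.
  by move=> kn; rewrite (lt_le_trans ltr01) // (entry_ge1 Aa).
apply: (iffP idP) => [Ft k kn|At].
  rewrite -ler_pdivrMr ?a_gt0 //; apply: le_trans Ft.
  apply: (@le_bigmax_seq _ _ _ (index_iota 2 n.+2) _ k xpredT
    (fun k => A_ x a k / entry a k)) => //.
  by rewrite mem_index_iota.
have At' k : (2 <= k <= n.+1)%N -> A_ x a k / entry a k <= t.
  by move=> kn; rewrite ler_pdivrMr ?At ?a_gt0.
rewrite /Fxa big_nat_cond; apply: bigmax_le => [|k /andP[kn _]];
  by apply: At'; lia.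
Qed.

(** Taking [x] to be the sum of the entries turns the double minimization over [x] and [a] into one
    over [a] alone. *)
Lemma Fxa_sum_continuous a :
  (forall k, (2 <= k <= n.+1)%N -> 1 <= entry a k) ->
  {for a, continuous
    (fun b : 'rV[R]_n => Fxa (\sum_(2 <= i < n.+2) entry b i) b)}.
Proof.
move=> a_ge1; pose X (b : 'rV[R]_n) := \sum_(2 <= i < n.+2) entry b i.
have cont k : (2 <= k <= n.+1)%N ->
    {for a, continuous (fun b : 'rV[R]_n => A_ (X b) b k / entry b k)}.
  move=> kn; apply: (@continuousM R _ (fun b => A_ (X b) b k)
    (fun b => (entry b k)^-1)); last first.
    apply: continuousV; last exact: entry_continuous.
    by rewrite gt_eqF // (lt_le_trans ltr01) // a_ge1.
  apply: (@continuousB R R^o _ (fun b => 2 * X b - 2 * (n%:R - k%:R + 1)));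
    last exact: sum_entry_continuous.
  apply: (@continuousB R R^o _ (fun b => 2 * X b)
    (fun=> 2 * (n%:R - k%:R + 1))); last exact: cst_continuous.
  apply: (@continuousM R _ (fun=> 2)); first exact: cst_continuous.
  exact: sum_entry_continuous.
suff bigmax_cont (s : seq nat) : {subset s <= index_iota 2 n.+2} ->
    continuous_at a (fun b : 'rV[R]_n =>
      \big[Num.max/A_ (X b) b 2 / entry b 2]_(k <- s)
        (A_ (X b) b k / entry b k)) by exact: bigmax_cont.
elim: s => [_|k s IH sub].
  by under eq_fun do rewrite big_nil; apply: cont; lia.
under eq_fun do rewrite big_cons.
apply: (@continuous_max R _ (fun b => A_ (X b) b k / entry b k)).
  by apply: cont; have := sub k (mem_head _ _); rewrite mem_index_iota.
by apply: IH => i si; apply: sub; rewrite inE si orbT.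
Qed.

(** The all-ones vector has value at most [n], while the [k = 2] term exceeds [2 n + 1] once
    [x > 2 n]. So it suffices to minimize over the compact set [K] where the sum is at most
    [2 n]. *)
Lemma Fn_attained :
  exists x a, [/\ n%:R <= x, calA n x a & Fn R n = Fxa x a].
Proof.
pose X (a : 'rV[R]_n) := \sum_(2 <= i < n.+2) entry a i.
pose K := [set a | calA n (X a) a /\ X a <= 2 * n%:R].
have X_ge a : calA n (X a) a -> n%:R <= X a.
  move=> Aa; have -> : (n%:R : R) = \sum_(2 <= i < n.+2) 1.
    by rewrite sumr_const_nat subn2.
  by apply: ler_sum_nat => i ilt; apply: (entry_ge1 Aa); lia.
pose e : 'rV[R]_n := const_mx 1.
have eE k : (2 <= k <= n.+1)%N -> entry e k = 1.
  case: k => [|[|k]] // kn; have kn' : (k < n)%N by lia.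
  by rewrite (entryE e (Ordinal kn')) mxE.
have Se k : (2 <= k <= n.+1)%N -> \sum_(2 <= i < k.+1) entry e i = k%:R - 1.
  move=> kn; rewrite (eq_big_nat _ _ (F2 := fun=> 1)) => [|i ik]; last first.
    by rewrite eE //; lia.
  by rewrite sumr_const_nat subSS natrB //; lia.
have n0 : 0 <= n%:R :> R by [].
have Xe : X e = n%:R by rewrite /X Se ?leqnn -?natr1; [ring|lia].
have Ae : calA n (X e) e.
  by split=> //; [apply: eE; lia|move=> k kn; rewrite !eE //; lia].
have Fe : Fxa (X e) e <= n%:R.
  apply/(Fxa_leP _ Ae) => k kn; rewrite /A_ eE // Se // Xe.
  have : k%:R <= n.+1%:R :> R by rewrite ler_nat; lia.
  by rewrite -natr1; lra.
have Kcompact : compact K.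
  apply: (@subclosed_compact _ _
    [set v : 'rV[R]_n | forall i : 'I_n, `[1, 2 * n%:R]%classic (v ord0 i)]).
  - rewrite (_ : K = [set a | entry a 2 = 1] `&`
      (\bigcap_(k in [set k | (2 <= k <= n)%N])
        [set a | 0 <= entry a k.+1 - entry a k])
      `&` [set a | X a <= 2 * n%:R]).
      apply: closedI; first apply: closedI.
      + apply: (closed_comp _ (@closed_eq R^o 1)) => a _.
        exact: entry_continuous.
      + apply: closed_bigI => k _; apply: (closed_comp _ (@closed_ge R 0)).
        move=> a _; apply: (@continuousB R R^o _ (fun b => entry b k.+1)
          (fun b => entry b k)); exact: entry_continuous.
      + apply: (closed_comp _ (@closed_le R (2 * n%:R))) => a _.
        exact: sum_entry_continuous.
    apply/seteqP; split => a /=.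
      by move=> [[a1 am _] aX]; do 2?split=> //; move=> k /= /am; rewrite subr_ge0.
    move=> [[a1 am] aX]; do 2?split=> //; move=> k /am /=.
    by rewrite subr_ge0.
  - apply: (@rV_compact R n (fun=> `[1, 2 * n%:R]%classic)) => _.
    exact: segment_compact.
  - move=> a [Aa aX] i; rewrite /= in_itv /= -entryE.
    have kn : (2 <= i.+2 <= n.+1)%N by have := ltn_ord i; lia.
    by rewrite (entry_ge1 Aa kn) (le_trans (entry_le Aa kn) aX).
have Ke : K e by split=> //; rewrite Xe; lra.
have Fcont : {within K, continuous (fun a : 'rV[R]_n => Fxa (X a) a)}.
  apply: continuous_in_subspaceT => a /set_mem[Aa _].
  by apply: Fxa_sum_continuous => k; exact: (entry_ge1 Aa).
have [a /set_mem[Aa _] amin] :=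
  compact_EVT_min (ex_intro _ e Ke) Kcompact Fcont.
exists (X a), a; split=> //; first exact: X_ge.
apply/eqP; rewrite eq_le Fn_le_Fxa ?X_ge //=.
apply: lb_le_inf; first exact: (Fn_has_inf R n2).1.
move=> _ [x /= nx <-]; have [b Ab [<- _]] := Fx_min n2 nx.
have [_ _ xb] := Ab; rewrite -xb in Ab nx *.
have [bX|bX] := leP (X b) (2 * n%:R); first by apply: amin; exact/mem_set.
apply: (@le_trans _ _ (Fxa (X e) e)); first by apply: amin; exact/mem_set.
apply: (le_trans Fe); have/(Fxa_leP _ Ab)/(_ 2%N) := lexx (Fxa (X b) b).
have [b1 _ _] := Ab; rewrite /A_ big_nat1 b1 => /(_ ltac:(lia)).
by rewrite -/(X b); lra.
Qed.

(** * Upper bounds for [Fn] from admissible sequences *)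

Lemma Fxa_le_sum x a t k : calA n x a -> Fxa x a <= t -> (2 <= k <= n.+1)%N ->
  t * \sum_(2 <= i < k) entry a i + 2 * (x - n%:R + k%:R - 1)
    <= (t + 1) * \sum_(2 <= i < k.+1) entry a i.
Proof.
move=> Aa /(Fxa_leP _ Aa) Ft kn; have := Ft k kn.
by rewrite /A_ (@big_nat_recr _ _ _ k 2) /=; [lra|lia].
Qed.

Lemma Fn_le_of_sums s x t :
  s 1%N = 0 -> s 2%N = 1 -> s n.+1 = x ->
  (forall k, (2 <= k <= n)%N -> s k - s k.-1 <= s k.+1 - s k) ->
  (forall k, (2 <= k <= n.+1)%N ->
    t * s k.-1 + 2 * (x - n%:R + k%:R - 1) <= (t + 1) * s k) ->
  n%:R <= x -> Fn R n <= t.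
Proof.
move=> s1 s2 sn smono st nx.
pose a : 'rV[R]_n := \row_(i < n) (s i.+2 - s i.+1).
have aE k : (2 <= k <= n.+1)%N -> entry a k = s k - s k.-1.
  case: k => [|[|k]] // kn; have kn' : (k < n)%N by lia.
  by rewrite (entryE a (Ordinal kn')) mxE.
have Sa k : (1 <= k <= n.+1)%N -> \sum_(2 <= i < k.+1) entry a i = s k.
  elim: k => [//|[|k] IH] kn; first by rewrite big_geq.
  by rewrite big_nat_recr //= IH ?aE //; [rewrite /=; ring|lia].
have Aa : calA n x a.
  split; first by rewrite aE /= ?s1 ?s2 ?subr0 //; lia.
  - by move=> k kn; rewrite !aE ?smono //; lia.
  - by rewrite Sa ?sn //; lia.
apply: (le_trans (Fn_le_Fxa nx Aa)); apply/(Fxa_leP _ Aa) => k kn.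
have := st k kn; rewrite /A_ Sa ?aE //; [lra|lia].
Qed.

Lemma Fn_le_of_gap l d t : (2 <= l <= n)%N -> 0 <= d <= 1 -> 0 < t ->
  l%:R - d <= t -> 0 <= gap l d t -> Fn R n <= t.
Proof.
move=> ln d01 t0 ldt; rewrite gapE; set x := _ + n%:R => gap0.
have q01 := ratio_bounds t0; set T := tight_sum l d t in gap0 *.
(* Entries 1 up to [l], then the tight sums, and finally [x], which is at least the last tight sum
   because [gap] is nonnegative. *)
pose s k := if (k <= l)%N then k%:R - 1 else if (k <= n)%N then T k else x.
have s_lo k : (k <= l)%N -> s k = k%:R - 1 by rewrite /s => ->.
have s_mid k : (l <= k <= n)%N -> s k = T k.
  move=> kn; rewrite /s; have [kl|kl] := leqP k l; last by rewrite ifT //; lia.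
  by have -> : k = l; [lia|rewrite /T tight_sum_start].
have s_hi : s n.+1 = x by rewrite /s ltnn ifF //; lia.
have s_ge k : (l <= k <= n.+1)%N -> T k <= s k.
  move=> kn; have [kn'|kn'] := leqP k n; first by rewrite s_mid //; lia.
  by have -> : k = n.+1; [lia|rewrite s_hi; lra].
have c01 : 0 <= (t + 1 - d) / (t + 1) <= 1.
  rewrite divr_ge0 /=; [|lra|lra].
  by rewrite ler_pdivrMr; lra.
have T_step k : (l <= k)%N -> 1 <= T k.+1 - T k.
  move=> lk; rewrite tight_sum_step //.
  have : 0 <= ratio t ^+ (k - l) <= 1.
    by rewrite exprn_ge0 ?exprn_ile1 //; lra.
  by nra.
have T_mono k : (l <= k)%N -> T k.+1 - T k <= T k.+2 - T k.+1.
  move=> lk; rewrite !tight_sum_step //; last lia.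
  rewrite subSn // exprS lerD2l lerN2 ler_wpM2l //; first lra.
  by rewrite ler_piMl ?exprn_ge0 //; lra.
apply: (@Fn_le_of_sums s x t) => //.
- by rewrite s_lo ?subrr //; lia.
- by rewrite s_lo; [lra|lia].
- move=> k kn; have [lk|kl] := ltnP l k.
    rewrite (s_mid k) ?(s_mid k.-1); [|lia|lia].
    case: k kn lk => [//|k] kn lk /=.
    by have := s_ge k.+2 ltac:(lia); have := T_mono k ltac:(lia); lra.
  rewrite (s_lo k) // (s_lo k.-1); last lia.
  have -> : k%:R - 1 - (k.-1%:R - 1) = 1 :> R.
    by rewrite -[k in k%:R](@prednK k) -?natr1; [ring|lia].
  have [kl'|lk] := ltnP k l; first by rewrite s_lo // -[k.+1%:R]natr1; lra.
  have -> : k = l by lia.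
  have := s_ge l.+1 ltac:(lia); have := T_step l (leqnn l).
  by rewrite [T l]tight_sum_start; lra.
- case=> [|k] // kn /=; have -> : x - n%:R + k.+1%:R - 1 =
    (t + d - l%:R) / 2 + k%:R by rewrite /x -[k.+1%:R]natr1; lra.
  have [lk|kl] := leqP l k.
    rewrite s_mid; last lia.
    have := s_ge k.+1 ltac:(lia); rewrite -(tight_sum_rec _ t0) // -/T.
    by rewrite ler_pM2l //; lra.
  (* Below [l] the constraint reduces to [k + d <= l], which follows from [k + 1 <= l] and
     [d <= 1]. *)
  rewrite !s_lo; [|lia|lia].
  have : k.+1%:R <= l%:R :> R by rewrite ler_nat.
  by rewrite -[k.+1%:R]natr1; lra.
- by rewrite /x; lra.
Qed.

Lemma Fn_lt_of_gap l d t : (2 <= l <= n)%N -> 0 <= d <= 1 -> 0 < t ->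
  l%:R - d < t -> 0 < gap l d t -> Fn R n < t.
Proof.
move=> ln d01 t0 ldt gap0.
have l2 : 2 <= l%:R :> R by rewrite ler_nat; lia.
(* The [ratio] term of [gap] increases with [t] and is subtracted, so lowering [t] by [e] lowers
   [gap] by at most [3 e / 2]. With [e <= gap / 2] it stays nonnegative; the other bound preserves
   [l - d <= t']. *)
pose t' := Num.max (l%:R - d) (t - gap l d t / 2).
have t't : t' < t by rewrite /t' gt_max; apply/andP; split; lra.
have lt' : l%:R - d <= t' by rewrite /t' le_max lexx.
have gt' : t - gap l d t / 2 <= t' by rewrite /t' le_max lexx orbT.
have t'0 : 0 < t' by lra.
apply: le_lt_trans t't; apply: (@Fn_le_of_gap l d t') => //.
have t't : t' <= t by rewrite /t' ge_max; apply/andP; split; lra.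
have /andP[q0 _] := ratio_bounds t'0.
have : (t' + 1 - d) * ratio t' ^+ (n.+1 - l)
    <= (t + 1 - d) * ratio t ^+ (n.+1 - l).
  apply: ler_pM; [lra|exact/exprn_ge0/ltW|lra|].
  by apply: lerXn2r; rewrite ?nnegrE ?ratio_homo //; apply/ltW;
    rewrite ?(andP (ratio_bounds t0)).1.
by move: gt' gap0; rewrite /gap; lra.
Qed.

(** Strictness gives [n < x] and [l <= n] at an optimum. The witness is [l = n], [d = 1],
    [t = n - 1/4], whose gap is already nonnegative at [n = 2]. *)
Lemma Fn_lt_n : Fn R n < n%:R.
Proof.
have n2' : 2 <= n%:R :> R by rewrite ler_nat.
apply: (@le_lt_trans _ _ (n%:R - 4^-1)); last lra.
apply: (@Fn_le_of_gap n 1); rewrite ?leqnn ?n2 //; try lra.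
rewrite /gap subSnn expr1 /ratio.
set N := n%:R : R; rewrite -/N in n2'.
have -> : 2 * (N - 4^-1) -
    (N - 4^-1 + 1 - 1) * ((N - 4^-1) / (N - 4^-1 + 1)) -
    (N - 4^-1 + 1 - N) / 2 - N =
  ((N + 3 / 4) * (3 / 4) - 2) / (2 * (N + 3 / 4)).
  by field; rewrite !gt_eqF //; lra.
by apply: divr_ge0; lra.
Qed.

(** * Rigidity of optimal points *)

(* The excess of the partial sums of [a] over the tight ones shrinks at most by
   the factor [ratio t] at each step. *)
Lemma tight_sum_le l d x a t k : calA n x a -> Fxa x a <= t -> 0 < t ->
  (1 <= l)%N -> t = 2 * (x - n%:R) + l%:R - d -> (l <= k <= n.+1)%N ->
  tight_sum l d t k <= \sum_(2 <= i < k.+1) entry a i.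
Proof.
move=> Aa Ft t0 l1 tE; elim: k => [|k IH] kn; first lia.
have [kl|lk] := ltnP k l.
  have -> : k.+1 = l by lia.
  by rewrite tight_sum_start; apply: (sum_entry_ge Aa); lia.
have [k0|k0] := posnP k; first lia.
have := Fxa_le_sum Aa Ft (k := k.+1) ltac:(lia).
have := tight_sum_rec d t0 lk; have := IH ltac:(lia).
have -> : (t + d - l%:R) / 2 = x - n%:R by lra.
rewrite -[k.+1%:R]natr1; set S := \sum_(2 <= i < k.+1) _ => h1 h2 h3.
by rewrite -(@ler_pM2l _ (t + 1)); [nra|lra].
Qed.

(** Zero gap gives equality at [n + 1]. Descending from there, the constraint at [k + 1] bounds the
    [k]-th partial sum above by the tight one, matching [tight_sum_le]. *)
Lemma tight_sum_eq l d x a t k : calA n x a -> Fxa x a <= t -> 0 < t ->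
  (1 <= l)%N -> t = 2 * (x - n%:R) + l%:R - d -> gap l d t = 0 ->
  (l <= k <= n.+1)%N ->
  \sum_(2 <= i < k.+1) entry a i = tight_sum l d t k.
Proof.
move=> Aa Ft t0 l1 tE gap0 kn; apply/eqP.
rewrite eq_le (tight_sum_le Aa Ft) // andbT.
have [m km] : exists m, (k + m = n.+1)%N by exists (n.+1 - k)%N; lia.
elim: m k kn km => [|m IH] k kn km.
  have -> : k = n.+1 by lia.
  have [_ _ ->] := Aa; move: gap0; rewrite gapE; lra.
have := IH k.+1 ltac:(lia) ltac:(lia).
have := Fxa_le_sum Aa Ft (k := k.+1) ltac:(lia).
have := tight_sum_rec d t0 (k := k) (l := l) ltac:(lia).
have -> : (t + d - l%:R) / 2 = x - n%:R by lra.
rewrite -[k.+1%:R]natr1; set S := \sum_(2 <= i < k.+1) _ => h1 h2 h3.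
by rewrite -(@ler_pM2l _ t) //; nra.
Qed.

(* If [gap l d t] did not depend on [d], then [t] would be a half-integer, and
   [ratio t ^+ j = 1/2] would make [2] a [j]-th power of a rational. *)
Lemma ratio_exp_neq_half l d t : (2 <= l <= n)%N -> 0 < t -> gap l d t = 0 ->
  ratio t ^+ (n.+1 - l) <> 1 / 2.
Proof.
move=> ln t0; rewrite /gap => gap0 q2; rewrite q2 in gap0.
(* Once the power is [1/2], [d] cancels and [gap = 0] says [2 t = p], so [ratio t = p / (p + 2)]. *)
pose p := (2 * n + 1 - l)%N; pose j := (n.+1 - l)%N.
have pE : p%:R = 2 * n%:R + 1 - l%:R :> R.
  by rewrite /p natrB; [rewrite natrD natrM|lia].
have tE : t = p%:R / 2 by rewrite pE; lra.
apply: (@exp_add2_neq p j); [rewrite /p; lia|rewrite /j; lia|].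
apply/eqP; rewrite -(eqr_nat R) natrM !natrX natrD.
have p20 : 0 < (p%:R + 2 : R) ^+ j by rewrite exprn_gt0 // tE in t0 *; lra.
have : (p%:R / (p%:R + 2)) ^+ j = 1 / 2 :> R.
  rewrite -q2; congr (_ ^+ _); rewrite /ratio tE.
  by field; rewrite -natr1 ?gt_eqF //; lra.
rewrite expr_div_n => e; have -> : p%:R ^+ j = 1 / 2 * (p%:R + 2 : R) ^+ j.
  by rewrite -e divfK // gt_eqF.
by apply/eqP; field.
Qed.

Lemma Fn_optimal x a : n%:R <= x -> calA n x a -> Fn R n = Fxa x a ->
  exists l, [/\ (2 <= l <= n)%N, 0 < Fn R n,
    Fn R n = 2 * (x - n%:R) + l%:R - 1 & gap l 1 (Fn R n) = 0].
Proof.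
move=> nx Aa FE; have Ft : Fxa x a <= Fn R n by rewrite FE.
have tn := Fn_lt_n; have t1 : 1 <= Fn R n by rewrite FE; exact: Fxa_ge1.
have noimp l d : (2 <= l <= n)%N -> 0 <= d <= 1 -> l%:R - d < Fn R n ->
    gap l d (Fn R n) <= 0.
  move=> ln d01 ldt; rewrite leNgt; apply/negP => g0.
  by have := Fn_lt_of_gap ln d01 (lt_le_trans ltr01 t1) ldt g0; rewrite ltxx.
set t := Fn R n in Ft tn t1 noimp *; have t0 : 0 < t by lra.
(* If [x = n], the last constraint and [S_n >= n - 1] force [t >= n]. *)
have x_gt : n%:R < x.
  rewrite lt_neqAle nx andbT; apply/eqP => xn.
  have := Fxa_le_sum Aa Ft (k := n.+1) ltac:(lia).
  have := sum_entry_ge (k := n) Aa ltac:(lia).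
  have [_ _ ->] := Aa; rewrite -xn -natr1.
  by set S := \sum_(2 <= i < n.+1) _ => h1 h2; nra.
pose m := t - 2 * (x - n%:R).
have m1 : 1 <= m.
  have := Fxa_le_sum Aa Ft (k := 2%N) ltac:(lia).
  by have [a1 _ _] := Aa; rewrite big_geq // big_nat1 a1 /m; lra.
(* Taking the least integer strictly above [m] makes [0 < d <= 1], with [d = 1] exactly when [m] is
   an integer. *)
pose l := (Num.truncn m).+1; have /andP[lm ml] := truncn_itv (le_trans ler01 m1).
have ln : (2 <= l <= n)%N.
  rewrite /l; apply/andP; split; first by rewrite ltnS truncn_gt0.
  by rewrite -(ltr_nat R) (le_lt_trans lm) // /m; lra.
pose d : R := l%:R - m.
have d01 : 0 < d <= 1 by rewrite /d /l; move: ml lm; rewrite -natr1; lra.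
have tE : t = 2 * (x - n%:R) + l%:R - d by rewrite /d /m; lra.
clearbody d l; clear m m1 lm ml.
have gap0 : gap l d t = 0.
  apply/eqP; rewrite eq_le noimp //=; [|lra|lra].
  have := tight_sum_le (l := l) (k := n.+1) Aa Ft t0 ltac:(lia) tE ltac:(lia).
  by rewrite gapE; have [_ _ ->] := Aa; lra.
have d1 : d = 1; last first.
  by rewrite d1 in tE gap0; exists l.
apply/eqP; rewrite eq_le (andP d01).2 /= leNgt; apply/negP => d1.
have gapD d' : gap l d' t = (d' - d) * (ratio t ^+ (n.+1 - l) - 1 / 2).
  by rewrite -[LHS]subr0 -gap0 /gap; ring.
have [q2|q2|] := ltgtP (ratio t ^+ (n.+1 - l)) (1 / 2).
(* Negative slope: decrease [d], but by at most [x - n], so that [l - d' < t] survives. *)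
- pose d' := Num.max 0 (d - (x - n%:R)).
  have d'd : d' < d by rewrite /d' gt_max; apply/andP; split; lra.
  have d'0 : 0 <= d' by rewrite /d' le_max lexx.
  have d'x : d - (x - n%:R) <= d' by rewrite /d' le_max lexx orbT.
  clearbody d'.
  have := noimp l d' ln ltac:(lra) ltac:(lra).
  by rewrite gapD leNgt nmulr_lgt0 ?subr_lt0 // d'd.
- have := noimp l 1 ln ltac:(lra) ltac:(lra).
  by rewrite gapD leNgt pmulr_rgt0 ?subr_gt0 // q2.
- exact: ratio_exp_neq_half gap0.
Qed.

End optimum.

Theorem theorem7p1 (R : realType) (n : nat) (hn : (2 <= n)%N) :
  (exists (x : R) (a : 'rV[R]_n),
      [/\ n%:R <= x, calA n x a & Fn R n = Fxa x a]) /\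
  (forall (x : R) (a : 'rV[R]_n),
      n%:R <= x -> calA n x a -> Fn R n = Fxa x a ->
      exists l : nat,
        [/\ (2 <= l <= n)%N,
            Fn R n = 2 * (x - n%:R) + l%:R - 1
            /\ (let theta := (Fn R n / (Fn R n + 1)) ^+ (n + 1 - l) in
                x = (2 - theta) * Fn R n),
            (forall k : nat, (2 <= k <= l)%N -> entry a k = 1)
            /\ (forall k : nat, (l <= k <= n + 1)%N ->
                  entry a k = 2 - (Fn R n / (Fn R n + 1)) ^+ (k - l))
          & forall k : nat, (l + 1 <= k <= n + 1)%N ->
              Fn R n = A_ x a k / entry a k]).
Proof.
split=> [|x a nx Aa FE]; first exact: Fn_attained.
have [l [ln t0 tE gap0]] := Fn_optimal hn nx Aa FE.
have Ft : Fxa x a <= Fn R n by rewrite FE.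
have S_hi k : (l <= k <= n.+1)%N ->
    \sum_(2 <= i < k.+1) entry a i = tight_sum l 1 (Fn R n) k.
  by move=> kn; apply: (tight_sum_eq hn Aa Ft t0) => //; lia.
set t := Fn R n in t0 tE gap0 Ft S_hi *.
(* Since [S_l = l - 1] and every entry is at least 1, there is no slack below [l]; the induction
   descends from [l]. *)
have S_lo j k : (k + j = l)%N -> (1 <= k)%N ->
    \sum_(2 <= i < k.+1) entry a i = k%:R - 1.
  elim: j k => [|j IH] k kj k1.
    have -> : k = l by lia.
    by rewrite S_hi ?tight_sum_start //; lia.
  apply/eqP; rewrite eq_le (sum_entry_ge Aa) ?andbT; last lia.
  have := IH k.+1 ltac:(lia) ltac:(lia).
  have := entry_ge1 (k := k.+1) Aa ltac:(lia).
  by rewrite big_nat_recr /= -?[k.+1%:R]natr1; [lra|lia].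
have a_lo k : (2 <= k <= l)%N -> entry a k = 1.
  case: k => [|k] // kl; have := S_lo (l - k.+1)%N k.+1 ltac:(lia) ltac:(lia).
  rewrite big_nat_recr /=; last lia.
  by rewrite (S_lo (l - k)%N k) -?[k.+1%:R]natr1; [lra|lia|lia].
have a_hi k : (l <= k <= n + 1)%N -> entry a k = 2 - ratio t ^+ (k - l).
  move=> kn; have [kl|lk] := leqP k l.
    by have -> : k = l; [lia|rewrite a_lo ?subnn ?expr0; [lra|lia]].
  case: k kn lk => [|k] // kn lk; have := S_hi k.+1 ltac:(lia).
  rewrite big_nat_recr /=; last lia.
  rewrite S_hi; last lia.
  move/(canRL (addKr _)) ->; rewrite addrC tight_sum_step //.
  by rewrite addrK subSn // exprS.
exists l; split=> //.
(* For [d = 1] one has [(t + 1 - l) / 2 = x - n], so [gap = 0] is the formula for [x]. *)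
- split=> //=; rewrite addn1 mulrBl.
  by move: gap0; rewrite /gap -/(ratio t) tE; lra.
- move=> k kn; have q01 : 0 < ratio t ^+ (k - l) <= 1.
    have /andP[q0 q1] := ratio_bounds t0.
    by rewrite exprn_gt0 ?exprn_ile1 ?ltW.
  rewrite a_hi; last lia.
  rewrite /A_ S_hi; last lia.
  apply/esym/(canLR (mulfK _)); first by rewrite gt_eqF //; lra.
  by rewrite /tight_sum; lra.
Qed.
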